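(* Let $n,m\in\mathbb{Z}$ and let $p\ge 2$ be an integer. Define polynomials $Q_k(u)$, $k\ge 0$, by $Q_0(u)=1$ and $$Q_{k+1}(u)=\big(n-k+(m+k(p-1))u\big)Q_k(u)+pu(1-u)Q_k'(u).$$ Then for every integer $k\ge 0$, $$\frac{\mathrm{d}^k}{\mathrm{d}t^k}\big(\mathrm{cq}^m t\cdot \mathrm{sq}^n t\big)=\mathrm{cq}^{m-k}t\cdot \mathrm{sq}^{n-k}t\;\frac{Q_k\big(-\mathrm{tq}^p t\big)}{(1+\mathrm{tq}^p t)^k}$$ for all $t\in(0,\tfrac{\pi_p}{2})$, and, if $p$ is even, for all $t\in\mathbb{R}$ with $\mathrm{sq}\,t\cdot\mathrm{cq}\,t\neq 0$.
   Context: For an integer $p\ge 2$, let $\mathrm{arcsq}(x)=\int_0^x(1-u^p)^{\frac1p-1}\,\mathrm{d}u$ for $x\in[0,1]$ and $\pi_p=2\,\mathrm{arcsq}(1)$. The squine $\mathrm{sq}$ is the inverse function of $\mathrm{arcsq}$ on $[0,\frac{\pi_p}{2}]$, and the cosquine is $\mathrm{cq}\,t=\mathrm{sq}(\frac{\pi_p}{2}-t)$. Both are extended to $\mathbb{R}$ by the same symmetries as sine and cosine: $\mathrm{sq}(\pi_p-t)=\mathrm{sq}\,t$, $\mathrm{sq}(-t)=-\mathrm{sq}\,t$, $2\pi_p$-periodicity, and $\mathrm{cq}\,t=\mathrm{sq}(\frac{\pi_p}{2}-t)$. On $[0,\frac{\pi_p}{2}]$ (and on all of $\mathbb{R}$ if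 $p$ is even) they satisfy $\mathrm{sq}'=\mathrm{cq}^{p-1}$, $\mathrm{cq}'=-\mathrm{sq}^{p-1}$, $\mathrm{sq}\,0=0$, $\mathrm{cq}\,0=1$, and $\mathrm{sq}^p t+\mathrm{cq}^p t=1$. The tanquent is $\mathrm{tq}\,t=\mathrm{sq}\,t/\mathrm{cq}\,t$. Powers such as $\mathrm{sq}^n t$ mean $(\mathrm{sq}\,t)^n$. *)

(* Defs.v *)
From mathcomp Require Import all_boot all_order all_algebra.
From mathcomp Require Import all_classical all_reals all_analysis.
From mathcomp Require Import ring lra.
Set Implicit Arguments.
Unset Strict Implicit.
Unset Printing Implicit Defensive.
Import Order.TTheory GRing.Theory Num.Theory.
Import numFieldNormedType.Exports.
Local Open Scope classical_set_scope.
Local Open Scope ring_scope.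

Section Squine.
Context {R : realType}.
Variable p : nat.
Implicit Types t x : R.

(* The integrand is unbounded near u = 1, so at x = 1 this is a Lebesgue
   integral of an unbounded integrable function.  The value of the integrand
   at u = 1 itself (0 `^ a = 0 for a != 0) is irrelevant. *)
Definition arcsq x : R :=
  \int[lebesgue_measure]_(u in `[0, x]) ((1 - u ^+ p) `^ (p%:R^-1 - 1)).

Definition pip : R := 2 * arcsq 1.

(* Inverse of arcsq : [0, 1] -> [0, pip / 2]; junk value 0 elsewhere. *)
Definition sq0 t : R := 'pinv_(fun=> 0) `[0, 1] arcsq t.

(* Index of the interval [(j - 1/2) pip, (j + 1/2) pip[ containing t. *)
Definition sq_turn t : int := Num.floor (t / pip + 2^-1).

(* Oddness and sq (pip - t) = sq t give sq (t + pip) = - sq t.  Hence, with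
   t = s + j * pip and s in [- pip / 2, pip / 2[, the prescribed symmetries
   force sq t = (-1) ^ j * sq s, where sq s = sgn s * sq0 |s| by oddness. *)
Definition sq t : R :=
  let s := t - (sq_turn t)%:~R * pip in
  (-1) ^ sq_turn t * (Num.sg s * sq0 `|s|).

Definition cq t : R := sq (pip / 2 - t).

Definition tq t : R := sq t / cq t.

Lemma sqDpip t : 0 < pip -> sq (t + pip) = - sq t.
Proof.
move=> pi0; have tE : sq_turn (t + pip) = sq_turn t + 1.
  rewrite /sq_turn mulrDl divff ?gt_eqF// addrAC.
  by rewrite floorDrz ?floor1 ?rpred1.
rewrite /sq tE intrD mulrDl mul1r opprD addrACA subrr addr0.
by rewrite expfzDr ?oppr_eq0 ?oner_eq0// expr1z mulrN1 mulNr.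
Qed.

Lemma sq_periodic t : 0 < pip -> sq (t + 2 * pip) = sq t.
Proof. by move=> pi0; rewrite mulr_natl mulr2n addrA !sqDpip// opprK. Qed.

Lemma sqN t : 0 < pip -> sq (- t) = - sq t.
Proof.
move=> pi0.
have sqDz (j : nat) x : sq (x + j%:R * pip) = (-1) ^+ j * sq x.
  elim: j x => [|j IH] x; first by rewrite mul0r addr0 mul1r.
  by rewrite -natr1 mulrDl mul1r addrA sqDpip// IH exprS mulN1r mulNr.
have sqDi (j : int) x : sq (x + j%:~R * pip) = (-1) ^ j * sq x.
  case: (intP j) => [|k|k]; first by rewrite mul0r addr0 expr0z mul1r.
    exact: sqDz.
  have := sqDz k.+1 (x - k.+1%:R * pip); rewrite subrK => ->.
  rewrite mulrNz mulNr -exprnN -exprVn invrN1 [RHS]mulrA -exprMn mulrNN mulr1.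
  by rewrite expr1n mul1r.
have sqmid s : - (pip / 2) < s < pip / 2 -> sq s = Num.sg s * sq0 `|s|.
  move=> /andP[s1 s2]; suff s0 : sq_turn s = 0.
    by rewrite /sq s0 mul0r subr0 expr0z mul1r.
  apply/floor_def; rewrite add0r mulr0z mulr1z.
  have : - 2^-1 < s / pip < 2^-1.
    by rewrite ltr_pdivlMr// ltr_pdivrMr//; apply/andP; split; lra.
  by move=> /andP[h1 h2]; apply/andP; split; lra.
set j := sq_turn t; set s := t - j%:~R * pip.
have tE : t = s + j%:~R * pip by rewrite subrK.
have /andP[s1 s2] : - (pip / 2) <= s < pip / 2.
  have /andP[] := floor_itv (t / pip + 2^-1); rewrite -/(sq_turn t) -/j.
  rewrite intrD mulr1z -lerBlDr -ltrBrDr ler_pdivlMr// ltr_pdivrMr//.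
  by move=> h1 h2; rewrite /s; apply/andP; split; lra.
have sN : sq (- s) = - sq s.
  have [s3|s3] := eqVneq s (- (pip / 2)).
    by rewrite -sqDpip// s3; congr sq; lra.
  have {}s1 : - (pip / 2) < s by rewrite lt_neqAle eq_sym s3.
  rewrite !sqmid; [|lra|lra].
  by rewrite sgrN normrN mulNr.
have -> : - t = - s + (- j)%:~R * pip by rewrite tE; ring.
rewrite [in RHS]tE !sqDi sN mulrN; congr (- (_ * _)).
by rewrite -exprz_inv invrN1.
Qed.

Lemma sq_pipB t : 0 < pip -> sq (pip - t) = sq t.
Proof. by move=> pi0; rewrite addrC sqDpip// sqN// opprK. Qed.

Lemma sq_sq0 t : 0 < t <= pip / 2 -> sq t = sq0 t.
Proof.
move=> /andP[t0 t1]; have pi0 : 0 < pip by lra.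
move: t1; rewrite le_eqVlt => /predU1P[->|t1].
  have tE : sq_turn (pip / 2) = 1.
    rewrite /sq_turn mulrAC divff ?gt_eqF// mul1r.
    by apply/floor_def; rewrite !mulr1z; apply/andP; split; lra.
  rewrite /sq tE expr1z mul1r.
  have -> : pip / 2 - pip = - (pip / 2) by lra.
  by rewrite sgrN normrN gtr0_sg ?gtr0_norm ?divr_gt0// mulN1r mulN1r opprK.
have tE : sq_turn t = 0.
  apply/floor_def; rewrite add0r mulr0z mulr1z.
  have : 0 < t / pip < 2^-1.
    by rewrite divr_gt0// ltr_pdivrMr//; lra.
  by move=> /andP[h1 h2]; apply/andP; split; lra.
by rewrite /sq tE mul0r subr0 expr0z mul1r gtr0_sg// mul1r gtr0_norm.
Qed.

End Squine.

Fixpoint Qpoly (R : nzRingType) (n m : int) (p k : nat) : {poly R} :=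
  if k is j.+1 then
    ((n - j%:Z)%:~R%:P + (m + j%:Z * (p%:Z - 1))%:~R *: 'X) * Qpoly R n m p j
    + p%:R *: ('X * (1 - 'X)) * (Qpoly R n m p j)^`()%R
  else 1.

(* Main.v *)
Require Import Defs.
From mathcomp Require Import all_boot all_order all_algebra.
From mathcomp Require Import all_classical all_reals all_analysis.
From mathcomp Require Import measurable_realfun ring.
Set Implicit Arguments.
Unset Strict Implicit.
Unset Printing Implicit Defensive.
Import Order.TTheory GRing.Theory Num.Theory.
Import numFieldNormedType.Exports.
Local Open Scope classical_set_scope.
Local Open Scope ring_scope.

(** At a point where [sq' = cq ^+ (p - 1)], [cq' = - sq ^+ (p - 1)],
    [sq ^+ p + cq ^+ p = 1] and neither function vanishes, the formula is an
    algebraic identity: with [u = - tq ^+ p] one has [1 - u = cq ^- p], and the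
    product and chain rules turn [Q_k(u)] into [Q_{k+1}(u)] by exactly the
    recursion that defines these polynomials ([is_derive_dpow]).  As the points
    in question form an open set, induction on [k] gives all derivatives
    ([derive1n_dpow]).

    The analysis lies in establishing the three relations from the definition
    of [sq] as the inverse of an improper integral.  The integrand is dominated
    by [(1 - u) `^ (p^-1 - 1)], whose primitive is continuous up to [u = 1], so
    that [arcsq] is continuous and increasing on [[0, 1]] and has the integrand
    as its derivative inside.  The map [pcompl : x |-> (1 - x ^+ p) `^ p^-1]
    exchanges the coordinates on the p-circle, and
    [arcsq x + arcsq (pcompl x)] has derivative zero; therefore
    [cq (arcsq x) = pcompl x] ([cq_arcsq]), which is the Pythagorean identity.
    The inverse function theorem then gives [sq'], and reflection at [pip / 4]
    gives [cq'], on [(0, pip / 2)] ([first_quadrant]).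

    For even [p] the relations are invariant under a quarter turn
    ([squine_atDpi2]), which carries them to every [t] that is not a multiple of
    [pip / 2]; at the multiples [sq * cq] vanishes. *)

(** * Preliminaries in one real variable *)

(** The outer function need only be continuous relative to [B]: at an endpoint
    of an interval [B] it may fail to be continuous on the line. *)
Lemma within_continuous_comp_sub {R : realType} (A B : set R) (f g : R -> R) :
  f @` A `<=` B -> {within A, continuous f} -> {within B, continuous g} ->
  {within A, continuous (g \o f)}.
Proof.
move=> fAB /subspace_continuousP cf /subspace_continuousP cg.
apply/subspace_continuousP => x Ax.
have Bfx : B (f x) by apply: fAB; exists x.
apply: (cvg_comp _ _ _ (cg _ Bfx)) => P /= BP.
have := cf x Ax _ BP; rewrite /nbhs /= /within /=.
apply: filterS => y fyP Ay; apply: fyP => //; apply: fAB; by exists y.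
Qed.

(** Integrability of a nonnegative function that may blow up at [b], from a
    primitive that stays continuous up to [b].  On [`[a, c]] with [c < b] the
    fundamental theorem of calculus gives [F c - F a <= F b - F a]; monotone
    convergence carries this bound to [`[a, b]]. *)
Lemma ge0_integrable_primitive {R : realType} (f F : R -> R) (a b : R) :
  measurable_fun `[a, b] f -> (forall x, x \in `[a, b] -> 0 <= f x) ->
  (forall c, c < b -> {within `[a, c], continuous f}) ->
  {within `[a, b], continuous F} ->
  (forall x, x \in `]a, b[ -> is_derive x 1 F (f x)) ->
  (@lebesgue_measure R).-integrable `[a, b] (EFin \o f).
Proof.
move=> mf f0 cf cF dF; have [ab|ba] := ltP a b; last first.
  move: ba; rewrite le_eqVlt => /predU1P[->|ba].
    apply: continuous_compact_integrable; first exact: segment_compact.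
    by rewrite set_itv1; exact: continuous_subspace1.
  by rewrite set_itv_ge ?bnd_simp -?ltNge//; exact: integrable_set0.
have F_le : {in `[a, b] &, {homo F : x y / x <= y}}.
  apply: ger0_derive1_le_cc => // x xab; first by case: (dF x xab).
  rewrite derive1E; case: (dF x xab) => _ ->.
  exact/f0/(subset_itv_oo_cc xab).
apply/integrableP; split; first exact/measurable_EFinP.
have -> : (\int[lebesgue_measure]_(x in `[a, b]) `|(EFin \o f) x| =
           \int[lebesgue_measure]_(x in `[a, b]) (EFin \o f) x)%E.
  by apply: eq_integral => x; rewrite inE /= => xab; rewrite ger0_norm ?f0.
rewrite -(@integral_itv_bndo_bndc _ (BLeft a)); last first.
  apply/measurable_EFinP; apply: measurable_funS mf => //.
  by apply: subset_itvl; rewrite bnd_simp.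
rewrite itv_bnd_open_bigcup.
have sub n : `[a, b - n.+1%:R^-1] `<=` `[a, b].
  by apply: subset_itvl; rewrite bnd_simp gerBl.
apply: (@le_lt_trans _ _ (F b - F a)%:E); last exact: ltry.
have cvI : (\int[lebesgue_measure]_(x in `[a, (b - n.+1%:R^-1)%R])
    (EFin \o f) x @[n --> \oo] --> \int[lebesgue_measure]_(x in
      \bigcup_n `[a, (b - n.+1%:R^-1)%R]%classic) (EFin \o f) x)%E.
  apply: (@ge0_nondecreasing_set_cvg_integral _ (measurableTypeR R) R
    (fun n : nat => [set` Interval (BLeft a) (BRight (b - n.+1%:R^-1))]))
    => //=.
  - move=> i j ij; rewrite subsetEset; apply: subset_itvl; rewrite bnd_simp.
    by rewrite lerD2l lerN2 lef_pV2 ?posrE// ler_nat.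
  - by move=> n; apply/measurable_EFinP; apply: measurable_funS mf.
  - by move=> n x /sub xab; rewrite lee_fin f0.
apply: (cvge_to_le cvI); apply: nearW => n.
have [ac|ca] := ltP a (b - n.+1%:R^-1); last first.
  (* For small [n] the truncated interval is empty or a point. *)
  rewrite (_ : (\int[_]_(_ in _) _ = 0)%E); last first.
    move: ca; rewrite le_eqVlt => /predU1P[->|ca].
      by rewrite set_itv1 integral_set1.
    by rewrite set_itv_ge ?integral_set0// bnd_simp -ltNge.
  by rewrite lee_fin subr_ge0; apply: F_le; rewrite ?in_itv/= ?lexx ltW.
have cb : b - n.+1%:R^-1 < b by rewrite gtrBl.
have cF' : {within `[a, b - n.+1%:R^-1], continuous F}.
  exact: continuous_subspaceW cF.
have suboo x : x \in `]a, b - n.+1%:R^-1[ -> x \in `]a, b[.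
  by rewrite !in_itv/= => /andP[-> /lt_trans->].
rewrite (@continuous_FTC2 _ f F) => //; last first.
- by move=> x /suboo xab; rewrite derive1E; case: (dF x xab).
- have [_ Fa Fc] := (continuous_within_itvP _ ac).1 cF'.
  by split => // x /suboo xab; case: (dF x xab).
- exact: cf.
by rewrite -EFinB lee_fin lerD2r; apply: F_le; rewrite ?in_itv/= ?lexx ?ltW.
Qed.

Lemma is_derive_shift {R : realType} (f : R -> R) (c t d : R) :
  is_derive (t + c) 1 f d -> is_derive t 1 (fun x => f (x + c)) d.
Proof.
move=> df; rewrite -[d]mulr1.
apply: (@is_derive1_comp _ f (fun x => x + c)) => //.
by apply: is_derive_eq; rewrite addr0.
Qed.

Lemma is_derive_reflect {R : realType} (f : R -> R) (c t d : R) :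
  is_derive (c - t) 1 f d -> is_derive t 1 (fun x => f (c - x)) (- d).
Proof.
move=> df; rewrite -mulrN1.
apply: (@is_derive1_comp _ f (fun x => c - x)) => //.
have -> : (fun x : R => c - x) = cst c - id by apply/funext => x; rewrite !fctE.
by apply: is_derive_eq; rewrite sub0r.
Qed.

Lemma is_derive_exprz {R : realType} (f : R -> R) (z : int) (x df : R) :
  f x != 0 -> is_derive x 1 f df ->
  is_derive x 1 (fun y => f y ^ z) (z%:~R * f x ^ (z - 1) * df).
Proof.
move=> fx0 dfx; have dX (n : nat) :
    is_derive x 1 (fun y => f y ^+ n) (n%:R * f x ^+ n.-1 * df).
  have -> : (fun y => f y ^+ n) = f ^+ n by apply/funext => y; rewrite fctE.
  exact: is_derive_eq (is_deriveX n dfx) _.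
case: (intP z) => [|n|n].
- rewrite mul0r mul0r; have -> : (fun y => f y ^ 0) = cst 1.
    by apply/funext => y; rewrite expr0z.
  exact: is_derive_cst.
- apply: is_derive_eq (dX n.+1) _.
  by rewrite -[(n.+1 : int)%:~R]/(n.+1%:R) -addn1 PoszD addrK addn1.
- have -> : (fun y => f y ^ (- n.+1%:Z)) = (fun y => (f y ^+ n.+1)^-1).
    by apply/funext => y; rewrite -exprnN.
  apply: is_derive_eq (is_deriveV _ (dX n.+1)) _; first by rewrite expf_neq0.
  have -> : - n.+1%:Z - 1 = - (n.+2)%:Z by rewrite -opprD -PoszD addn1.
  rewrite -exprnN mulrNz -[(n.+1 : int)%:~R]/(n.+1%:R) /GRing.scale/=.
  rewrite !exprS; field.
  by rewrite fx0 expf_neq0.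
Qed.

Lemma is_derive_onemX_powR {R : realType} (n : nat) (r u : R) : u ^+ n < 1 ->
  is_derive u 1 (fun v => (1 - v ^+ n) `^ r)
    (- (r * (1 - u ^+ n) `^ (r - 1) * (n%:R * u ^+ n.-1))).
Proof.
move=> un1; rewrite -mulrN.
apply: (@is_derive1_comp _ (@powR R ^~ r) (fun v => 1 - v ^+ n)).
  by apply: is_derive1_powR; rewrite subr_gt0.
have -> : (fun v : R => 1 - v ^+ n) = cst 1 - (@id R) ^+ n.
  by apply/funext => v; rewrite /= !fctE.
by apply: is_derive_eq; rewrite sub0r /= [_ *: 1]mulr1.
Qed.

(** * The arcsquine *)

Section arcsquine.
Context {R : realType}.
Variable p : nat.
Hypothesis p_gt1 : (1 < p)%N.

Definition arcsq_integrand (u : R) : R := (1 - u ^+ p) `^ (p%:R^-1 - 1).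

(** Parametrizes the arc of the p-circle [x ^ p + y ^ p = 1] in the first
    quadrant by its abscissa; it is how [cq t] depends on [sq t] there. *)
Definition pcompl (x : R) : R := (1 - x ^+ p) `^ p%:R^-1.

Let p_gt0 : (0 < p)%N. Proof. exact: ltnW. Qed.
Let pR_gt0 : 0 < p%:R :> R. Proof. by rewrite ltr0n. Qed.
Let pR_neq0 : p%:R != 0 :> R. Proof. by rewrite gt_eqF. Qed.

Let powR_invK (x : R) : 0 <= x -> (x `^ p%:R^-1) ^+ p = x.
Proof.
by move=> x0; rewrite -powR_mulrn ?powR_ge0// -powRrM mulVf// powRr1.
Qed.

Let powR_Kinv (x : R) : 0 <= x -> (x ^+ p) `^ p%:R^-1 = x.
Proof. by move=> x0; rewrite -powR_mulrn// -powRrM mulfV// powRr1. Qed.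

Lemma pcompl_ge0 x : 0 <= pcompl x. Proof. exact: powR_ge0. Qed.

Lemma pcomplX (x : R) : x \in `[0, 1] -> pcompl x ^+ p = 1 - x ^+ p.
Proof.
by rewrite in_itv/= => /andP[x0 x1]; rewrite powR_invK// subr_ge0 exprn_ile1.
Qed.

Lemma pcompl_itv (x : R) : x \in `[0, 1] -> pcompl x \in `[0, 1].
Proof.
move=> x01; rewrite in_itv/= pcompl_ge0/= -(@expr_le1 _ p)//; last first.
  exact: pcompl_ge0.
move: x01 (x01); rewrite {1}in_itv/= => /andP[x0 x1] x01.
by rewrite pcomplX// gerBl exprn_ge0.
Qed.

Lemma pcomplK : {in `[0, 1], cancel pcompl pcompl}.
Proof.
move=> x x01; rewrite {1}/pcompl pcomplX// subKr powR_Kinv//.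
by move: x01; rewrite in_itv/= => /andP[].
Qed.

Lemma pcompl0 : pcompl 0 = 1.
Proof. by rewrite /pcompl expr0n gtn_eqF// subr0 powR1. Qed.

Lemma pcompl1 : pcompl 1 = 0.
Proof. by rewrite -pcompl0 pcomplK// in_itv/= lexx ler01. Qed.

Lemma pcompl_itvoo (x : R) : x \in `]0, 1[ -> pcompl x \in `]0, 1[.
Proof.
move=> x01; have x01' : x \in `[0, 1] := subset_itv_oo_cc x01.
have := pcompl_itv x01'; rewrite !in_itv/= !le_eqVlt.
move: x01; rewrite in_itv/= => /andP[x0 x1].
have /negbTE-> : pcompl x != 1.
  by apply: contraTneq x0 => c1; rewrite -(pcomplK x01') c1 pcompl1 ltxx.
have /negbTE-> : 0 != pcompl x.
  by apply: contraTneq x1 => c0; rewrite -(pcomplK x01') -c0 pcompl0 ltxx.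
by [].
Qed.

(** At [y = 1] this fails to be continuous from the right, because [powR] is 1
    on negative numbers.  Continuity on the segment comes for free from its
    being the inverse of the monotone function [1 - x ^+ p]. *)
Lemma root_onem_continuous :
  {within `[0, 1], continuous (fun y : R => (1 - y) `^ p%:R^-1)}.
Proof.
have := @segment_can_ge_continuous R 0 1 (fun x => 1 - x ^+ p)
  (fun y : R => (1 - y) `^ p%:R^-1) ler01.
rewrite expr1n subrr expr0n gtn_eqF// subr0; apply.
  apply: continuous_subspaceT => x; apply: cvgB; first exact: cvg_cst.
  exact: exprn_continuous.
by move=> x /andP[x0 _]; rewrite subKr powR_Kinv.
Qed.

Lemma pcompl_continuous : {within `[0, 1], continuous pcompl}.
Proof.
have -> : pcompl = (fun y => (1 - y) `^ p%:R^-1) \o (fun x => x ^+ p) by [].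
apply: (@within_continuous_comp_sub _ _ `[0, 1]).
- move=> _ [x /= /andP[x0 x1] <-]; apply/andP; split; rewrite bnd_simp.
    exact: exprn_ge0.
  by apply: exprn_ile1.
- exact/continuous_subspaceT/exprn_continuous.
- exact: root_onem_continuous.
Qed.

Lemma is_derive_pcompl (x : R) : x \in `]0, 1[ ->
  is_derive x 1 pcompl (- (arcsq_integrand x * x ^+ p.-1)).
Proof.
rewrite in_itv/= => /andP[x0 x1].
have xp1 : x ^+ p < 1 by rewrite exprn_ilt1 ?ltW// -lt0n.
apply: is_derive_eq (is_derive_onemX_powR p%:R^-1 xp1) _.
by rewrite mulrA -[_ * _ * p%:R]mulrA [_ * p%:R]mulrC mulrA mulVf// mul1r.
Qed.

Lemma arcsq_integrand_gt0 u : 0 <= u < 1 -> 0 < arcsq_integrand u.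
Proof.
move=> /andP[u0 u1]; apply: powR_gt0.
by rewrite subr_gt0 exprn_ilt1// -lt0n.
Qed.

(** Since [u ^+ p <= u], the integrand is at most [(1 - u) `^ (p^-1 - 1)], which
    has the primitive [- p * (1 - u) `^ p^-1], continuous up to [u = 1]. *)
Lemma arcsq_integrand_integrable :
  (@lebesgue_measure R).-integrable `[0, 1] (EFin \o arcsq_integrand).
Proof.
have mf n : measurable_fun setT (fun u : R => (1 - u ^+ n) `^ (p%:R^-1 - 1)).
  have -> : (fun u : R => (1 - u ^+ n) `^ (p%:R^-1 - 1)) =
    (@powR R ^~ (p%:R^-1 - 1)) \o (fun u => 1 - u ^+ n) by [].
  apply: measurableT_comp; first exact: measurable_powR.
  apply: measurable_funB => //; exact: exprn_measurable.
have mf1 : measurable_fun setT (fun u : R => (1 - u) `^ (p%:R^-1 - 1)).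
  exact: (mf 1%N).
apply: (@le_integrable _ (measurableTypeR R) R lebesgue_measure _ _ _
    (EFin \o (fun u : R => (1 - u) `^ (p%:R^-1 - 1)))) => //.
- by apply/measurable_EFinP/measurable_funTS; exact: mf.
- move=> u /= /andP[u0 u1]; rewrite !bnd_simp in u0 u1.
  rewrite lee_fin !ger0_norm ?powR_ge0//.
  move: u1; rewrite le_eqVlt => /predU1P[->|u1].
    by rewrite /arcsq_integrand expr1n.
  have u1' : 0 < 1 - u by rewrite subr_gt0.
  have up : 1 - u <= 1 - u ^+ p.
    by rewrite lerD2l lerN2 -[leRHS]expr1 ler_wiXn2l// ltW.
  have up' := lt_le_trans u1' up.
  rewrite /arcsq_integrand -[p%:R^-1 - 1]opprB !powRN.
  rewrite lef_pV2 ?posrE ?powR_gt0//.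
  apply: ge0_ler_powR => //; rewrite ?nnegrE; [|exact: ltW..].
  by rewrite subr_ge0 invf_le1// ler1n.
apply: (ge0_integrable_primitive (F := fun u => - (p%:R * (1 - u) `^ p%:R^-1))).
- exact: measurable_funTS.
- by move=> x _; exact: powR_ge0.
- move=> c c1.
  apply: derivable_within_continuous => x /andP[_]; rewrite bnd_simp => xc.
  have := @is_derive_onemX_powR R 1 (p%:R^-1 - 1) x (le_lt_trans xc c1).
  by case.
- apply: (@within_continuous_comp R R R _ (fun y => (1 - y) `^ p%:R^-1)
    (fun z => - (p%:R * z))); last exact: root_onem_continuous.
  by move=> z _; apply: cvgN; apply: cvgMr; exact: cvg_id.
- move=> x; rewrite in_itv/= => /andP[x0 x1].
  have dx := @is_derive_onemX_powR R 1 p%:R^-1 x x1.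
  have -> : (fun u : R => - (p%:R * (1 - u) `^ p%:R^-1)) =
            - (p%:R *: (fun u : R => (1 - u ^+ 1) `^ p%:R^-1)).
    by apply/funext => u; rewrite !fctE.
  apply: is_derive_eq.
  by rewrite expr0 !mulr1 scalerN opprK /GRing.scale/= mulrA mulfV// mul1r.
Qed.

(** In terms of the conjugate coordinate the integrand is [y ^- (p - 1)]; hence
    the inverse function of [arcsq] has derivative [cq ^+ (p - 1)]. *)
Lemma arcsq_integrandE (x : R) : x \in `]0, 1[ ->
  arcsq_integrand x = (pcompl x ^+ p.-1)^-1.
Proof.
rewrite in_itv/= => /andP[x0 x1].
have xp1 : 0 < 1 - x ^+ p by rewrite subr_gt0 exprn_ilt1 ?ltW// -lt0n.
rewrite -powR_mulrn ?pcompl_ge0// -powRrM -powRN; congr (_ `^ _).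
by rewrite -subn1 natrB// mulrBr mulVf// mulr1 opprB.
Qed.

Lemma arcsq_continuous : {within `[0, 1], continuous (arcsq p : R -> R)}.
Proof. exact: parameterized_integral_continuous arcsq_integrand_integrable. Qed.

Lemma is_derive_arcsq (x : R) : x \in `]0, 1[ ->
  is_derive x 1 (arcsq p) (arcsq_integrand x).
Proof.
rewrite in_itv/= => /andP[x0 x1].
have xp1 : x ^+ p < 1 by rewrite exprn_ilt1 ?ltW// -lt0n.
have cx : {for x, continuous arcsq_integrand}.
  apply/differentiable_continuous/derivable1_diffP.
  by case: (is_derive_onemX_powR (p%:R^-1 - 1) xp1).
have [dF F'x] := continuous_FTC1_closed x1 arcsq_integrand_integrable x0 cx.
by split; [exact: dF|rewrite -derive1E; exact: F'x].
Qed.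

Lemma arcsq0 : arcsq p 0 = 0 :> R.
Proof. by rewrite /arcsq set_itv1 Rintegral_set1. Qed.

Lemma arcsq_lt : {in `[0, 1] &, {homo arcsq p : x y / x < y :> R}}.
Proof.
apply: gtr0_derive1_lt_cc arcsq_continuous => x x01.
  by case: (is_derive_arcsq x01).
rewrite derive1E; case: (is_derive_arcsq x01) => _ ->.
by apply: arcsq_integrand_gt0; move: x01; rewrite in_itv/= => /andP[/ltW-> ->].
Qed.

Lemma arcsq_mono : {in `[0, 1] &, {mono arcsq p : x y / x <= y :> R}}.
Proof. exact/le_mono_in/arcsq_lt. Qed.

Let zero01 : (0 : R) \in `[0, 1]. Proof. by rewrite in_itv/= lexx ler01. Qed.
Let one01 : (1 : R) \in `[0, 1]. Proof. by rewrite in_itv/= lexx ler01. Qed.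

Lemma arcsq1 : arcsq p 1 = pip p / 2 :> R.
Proof. by rewrite /pip mulrAC divff ?mul1r. Qed.

Lemma pip_gt0 : 0 < pip p :> R.
Proof. by rewrite mulr_gt0// -[ltLHS]arcsq0 arcsq_lt. Qed.

(** The p-circle is symmetric under exchange of the coordinates: by
    [arcsq_integrandE] at [pcompl x], whose conjugate is [x], the sum has
    derivative zero, and at [x = 1] it is [arcsq 1 + arcsq 0].  This is the
    Pythagorean identity in disguise, for it says that [cq (arcsq x) = pcompl x]. *)
Lemma arcsq_pcompl (x : R) : x \in `[0, 1] ->
  arcsq p x + arcsq p (pcompl x) = pip p / 2.
Proof.
move=> x01; pose g (y : R) := arcsq p y + arcsq p (pcompl y).
have g1 : g 1 = pip p / 2 by rewrite /g pcompl1 arcsq0 addr0 arcsq1.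
have x1 : x <= 1 by move: x01; rewrite in_itv/= => /andP[].
have sub : `[x, 1] `<=` `[0, 1].
  apply: subset_itvr; rewrite bnd_simp.
  by move: x01; rewrite in_itv/= => /andP[].
have : {within `[x, 1], continuous g}.
  apply: (continuous_subspaceW sub) => y; apply: cvgD.
    exact: arcsq_continuous.
  apply: (@within_continuous_comp_sub _ _ `[0, 1] pcompl (arcsq p)).
  - by move=> _ [z z01 <-]; exact: pcompl_itv.
  - exact: pcompl_continuous.
  - exact: arcsq_continuous.
have dg y : y \in `]x, 1[ -> is_derive y 1 g 0.
  move=> yx1; have y01 : y \in `]0, 1[.
    move: yx1 x01; rewrite !in_itv/= => /andP[xy ->] /andP[x0 _].
    by rewrite (le_lt_trans x0 xy).
  have dy := is_derive_arcsq y01.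
  have dcy := is_derive_arcsq (pcompl_itvoo y01).
  have dc := is_derive_pcompl y01.
  apply: (is_derive_eq (is_deriveD dy (is_derive1_comp dcy dc))).
  rewrite (arcsq_integrandE (pcompl_itvoo y01)) pcomplK; last first.
    exact: subset_itv_oo_cc y01.
  rewrite mulrN mulrCA mulVf ?mulr1 ?subrr// expf_neq0//.
  by move: y01; rewrite in_itv/= => /andP[y0 _]; rewrite gt_eqF.
move=> /(MVT_segment x1 dg)[c _]; rewrite mul0r => /eqP.
by rewrite subr_eq0 g1 => /eqP ->.
Qed.

Lemma arcsq_onto (t : R) : 0 < t < pip p / 2 ->
  exists2 x, x \in `]0, 1[ & arcsq p x = t.
Proof.
move=> /andP[t0 t1].
have [|x x01 xt] := IVT (v := t) ler01 arcsq_continuous.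
  rewrite arcsq0 arcsq1 ge_min le_max !(ltW t0) !(ltW t1)/=.
  by rewrite orbT.
exists x => //; move: x01; rewrite !in_itv/= !le_eqVlt.
move=> /andP[/predU1P[x0|->] /predU1P[x1|->]]//.
- by move: t0; rewrite -xt -x0 arcsq0 ltxx.
- by move: t0; rewrite -xt -x0 arcsq0 ltxx.
- by move: t1; rewrite -xt x1 arcsq1 ltxx.
Qed.

Lemma arcsqK (x : R) : x \in `]0, 1] -> sq p (arcsq p x) = x.
Proof.
rewrite in_itv/= => /andP[x0 x1].
have x01 : x \in `[0, 1] by rewrite in_itv/= ltW.
rewrite sq_sq0; last first.
  rewrite -[ltLHS]arcsq0 arcsq_lt//= -arcsq1 le_eqVlt.
  move: x1; rewrite le_eqVlt => /predU1P[->|x1]; first by rewrite eqxx.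
  by rewrite arcsq_lt ?orbT.
rewrite /sq0 pinvKV => [//|y z|]; last exact: mem_set.
rewrite !inE => y01 z01; exact: (inc_inj_in arcsq_mono).
Qed.

Lemma cq_arcsq (x : R) : x \in `]0, 1[ -> cq p (arcsq p x) = pcompl x.
Proof.
move=> x01; have x01' : x \in `[0, 1] := subset_itv_oo_cc x01.
rewrite /cq -(arcsq_pcompl x01') addrAC subrr add0r arcsqK//.
have := pcompl_itvoo x01; rewrite !in_itv/= => /andP[-> /ltW //].
Qed.

End arcsquine.

(** * Derivatives of squine and cosquine *)

Section squine_calculus.
Context {R : realType}.
Variable p : nat.
Hypothesis p_gt1 : (1 < p)%N.
Implicit Types t x : R.

(** The differential system and the equation of the p-circle at one point, kept
    together because a quarter turn transports them only together. *)
Definition squine_at t := [/\ is_derive t 1 (sq p) (cq p t ^+ p.-1),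
  is_derive t 1 (cq p) (- sq p t ^+ p.-1) & sq p t ^+ p + cq p t ^+ p = 1].

Let pi2_gt0 : 0 < pip p / 2 :> R.
Proof. by rewrite divr_gt0// pip_gt0. Qed.

Lemma cq_compl t : cq p (pip p / 2 - t) = sq p t.
Proof. by rewrite /cq opprB addrC subrK. Qed.

Lemma is_derive_sq t : 0 < t < pip p / 2 ->
  is_derive t 1 (sq p) (cq p t ^+ p.-1).
Proof.
move=> /(arcsq_onto p_gt1)[x x01 <-]; rewrite cq_arcsq//.
rewrite -[_ ^+ _]invrK -arcsq_integrandE//; apply: is_derive_inverse.
- apply: filterS (near_in_itvoo x01) => z z01; apply: arcsqK => //.
  by move: z01; rewrite !in_itv/= => /andP[-> /ltW].
- apply: filterS (near_in_itvoo x01) => z z01.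
  apply/differentiable_continuous/derivable1_diffP.
  by case: (is_derive_arcsq p_gt1 z01).
- exact: is_derive_arcsq.
- rewrite gt_eqF// arcsq_integrand_gt0//.
  by move: x01; rewrite in_itv/= => /andP[/ltW-> ->].
Qed.

Lemma first_quadrant t : 0 < t < pip p / 2 ->
  [/\ squine_at t, sq p t != 0 & cq p t != 0].
Proof.
move=> t01; have [x x01 xt] := arcsq_onto p_gt1 t01.
have xt0 : sq p t = x.
  rewrite -xt arcsqK//.
  by move: x01; rewrite !in_itv/= => /andP[-> /ltW].
have ct : cq p t = pcompl p x by rewrite -xt cq_arcsq.
have x01' : x \in `[0, 1] := subset_itv_oo_cc x01.
split.
- split; first exact: is_derive_sq.
    have -> : cq p = (fun s : R => sq p (pip p / 2 - s)) by [].
    have := @is_derive_sq (pip p / 2 - t).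
    rewrite cq_compl => dsq.
    apply: is_derive_reflect; apply: dsq.
    by move: t01 => /andP[t0 t1]; rewrite subr_gt0 t1 gtrBl.
  by rewrite xt0 ct pcomplX// addrC subrK.
- by rewrite xt0; move: x01; rewrite in_itv/= => /andP[x0 _]; rewrite gt_eqF.
- rewrite ct; have := pcompl_itvoo p_gt1 x01.
  by rewrite in_itv/= => /andP[x0 _]; rewrite gt_eqF.
Qed.

Lemma sqDpi2 t : sq p (t + pip p / 2) = cq p t.
Proof.
rewrite -sq_pipB ?pip_gt0// /cq; congr (sq p _).
by rewrite [X in X - _]splitr opprD addrACA subrr addr0 addrC.
Qed.

Lemma cqDpi2 t : cq p (t + pip p / 2) = - sq p t.
Proof.
rewrite -sqN ?pip_gt0// /cq; congr (sq p _).
by rewrite opprD addrCA subrr addr0.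
Qed.

Lemma sq_at0 : sq p 0 = 0 :> R.
Proof.
have := @sqN R p 0 (pip_gt0 p_gt1).
by rewrite oppr0 => /eqP; rewrite -subr_eq0 opprK -mulr2n mulrn_eq0 => /eqP.
Qed.

Let sqBpi2 t : sq p t = - cq p (t + pip p / 2).
Proof. by rewrite cqDpi2 opprK. Qed.

Hypothesis p_even : ~~ odd p.

Let p1_odd : odd p.-1.
Proof. by case: p p_gt1 p_even => //= n _; rewrite negbK. Qed.

(** A quarter turn maps [(sq, cq)] to [(cq, - sq)].  The system
    [sq' = cq ^+ (p - 1)], [cq' = - sq ^+ (p - 1)] and the p-circle are
    invariant under this map because [p - 1] is odd and [p] even. *)
Lemma squine_atDpi2 t : squine_at (t + pip p / 2) <-> squine_at t.
Proof.
split=> [[]|[dsq dcq sc1]].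
  rewrite sqDpi2 cqDpi2 exprNn -signr_odd p1_odd expr1 mulN1r => dsq dcq.
  rewrite exprNn -signr_odd (negbTE p_even) expr0 mul1r addrC => sc1.
  split => //.
    have -> : sq p = - (fun x : R => cq p (x + pip p / 2)).
      by apply/funext => x; rewrite fctE/= -sqBpi2.
    apply: (is_derive_eq (is_deriveN (is_derive_shift dcq))).
    by rewrite opprK.
  have -> : cq p = (fun x : R => sq p (x + pip p / 2)).
    by apply/funext => x; rewrite sqDpi2.
  exact: is_derive_shift.
set h := pip p / 2; split; rewrite ?sqDpi2 ?cqDpi2.
- have sqE : sq p = (fun x : R => cq p (x - h)).
    by apply/funext => x; rewrite -sqDpi2 subrK.
  rewrite exprNn -signr_odd p1_odd expr1 mulN1r [X in is_derive _ _ X]sqE.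
  by apply: is_derive_shift; rewrite addrK.
- have cqE : cq p = - (fun x : R => sq p (x - h)).
    by apply/funext => x; rewrite fctE/= -cqDpi2 subrK.
  rewrite [X in is_derive _ _ X]cqE.
  by apply: is_deriveN; apply: is_derive_shift; rewrite addrK.
- by rewrite exprNn -signr_odd (negbTE p_even) expr0 mul1r addrC.
Qed.

(** Quarter turns bring [t] to [[0, pip / 2[].  The endpoint [0], where [sq]
    vanishes, is excluded by the hypothesis, so only derivatives in the open
    first quadrant are ever needed. *)
Lemma even_squine_at t : sq p t * cq p t != 0 -> squine_at t.
Proof.
pose h : R := pip p / 2; pose P (x : R) := sq p x * cq p x != 0 -> squine_at x.
have PD x : P (x + h) <-> P x.
  rewrite /P sqDpi2 cqDpi2 mulrN oppr_eq0 mulrC.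
  by split=> H /H; [move/(squine_atDpi2 x).1|move/(squine_atDpi2 x).2].
have P0 x : 0 <= x < h -> P x.
  rewrite le_eqVlt => /andP[/predU1P[<-|x0] xh].
    by rewrite /P sq_at0 mul0r eqxx.
  by move=> _; have [] := @first_quadrant x; rewrite ?x0.
have Pj (j : int) x : P x -> P (x + j%:~R * h).
  move=> Px; have succE (i : int) : x + (i + 1)%:~R * h = x + i%:~R * h + h.
    by rewrite intrD mulrDl mul1r addrA.
  elim/int_ind: j => [|n|n]; first by rewrite mul0r addr0.
    by rewrite -addn1 PoszD succE => /PD.
  rewrite -[X in P (x + X%:~R * h) -> _](subrK 1) succE => /PD.
  by rewrite -opprD -PoszD addn1.
rewrite -/(P t) -[t](subrK ((Num.floor (t / h))%:~R * h)); apply/Pj/P0.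
have /andP[] := floor_itv (t / h).
rewrite ler_pdivlMr// ltr_pdivrMr// intrD mulrDl mul1r subr_ge0 => -> /=.
by rewrite ltrBlDl.
Qed.

End squine_calculus.

(** * Iterated derivatives *)

Section derivatives.
Context {R : realType}.
Variables (n m : int) (p : nat).
Hypothesis p_gt1 : (1 < p)%N.

Local Notation f := (fun x : R => cq p x ^ m * sq p x ^ n).

(** The k-th derivative with its denominator cleared: on the p-circle
    [1 + tq ^+ p = cq ^- p], so dividing by the k-th power of it adds [k * p] to
    the exponent of [cq]. *)
Definition dpow (k : nat) (x : R) : R :=
  cq p x ^ (m - k%:Z + (k * p)%:Z) * sq p x ^ (n - k%:Z) *
  (Qpoly R n m p k).[- tq p x ^+ p].

Lemma dpowE k x : squine_at p x -> cq p x != 0 ->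
  dpow k x = cq p x ^ (m - k%:Z) * sq p x ^ (n - k%:Z) *
    ((Qpoly R n m p k).[- tq p x ^+ p] / (1 + tq p x ^+ p) ^+ k).
Proof.
move=> [_ _ sc1] c0.
have -> : 1 + tq p x ^+ p = (cq p x ^+ p)^-1.
  by rewrite /tq expr_div_n -[X in X + _](@divff _ (cq p x ^+ p)) ?expf_neq0//
    -mulrDl addrC sc1 mul1r.
rewrite /dpow exprVn invrK -exprM (expfzDr _ _ c0) [(k * p)%N]mulnC /=.
by rewrite -exprnP; ring.
Qed.

Lemma is_derive_tq (x : R) : squine_at p x -> cq p x != 0 ->
  is_derive x 1 (tq p) (cq p x ^- 2).
Proof.
move=> [dsq dcq sc1] c0.
have -> : tq p = sq p * (fun y : R => (cq p y)^-1).
  by apply/funext => y; rewrite fctE.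
apply: is_derive_eq (is_deriveM dsq (is_deriveV c0 dcq)) _.
have expE (y : R) : y ^+ p = y * y ^+ p.-1 by rewrite -exprS prednK// ltnW.
rewrite -[RHS]mulr1 -sc1 !expE /GRing.scale/= {dsq dcq sc1}.
move: (sq p x) (cq p x) c0 => s c c0.
move: (s ^+ p.-1) (c ^+ p.-1) => s' c'.
by field.
Qed.

(** The step that explains the recursion for [Qpoly].  Put [u = - tq ^+ p] and
    let [a], [b] be the exponents of [cq], [sq] in [dpow k].  Since
    [1 - u = cq ^- p], differentiating the powers gives
    [cq ^ (a - 1 + p) * sq ^ (b - 1) * (b + a * u)], and differentiating
    [Q_k(u)], with [u' = - p * tq ^+ (p - 1) * cq ^- 2], gives the same powers
    times [p * u * (1 - u) * Q_k'(u)]. *)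
Lemma is_derive_dpow k (x : R) : squine_at p x -> sq p x != 0 -> cq p x != 0 ->
  is_derive x 1 (dpow k) (dpow k.+1 x).
Proof.
move=> sqx s0 c0; have [dsq dcq sc1] := sqx.
pose a := m - k%:Z + (k * p)%:Z; pose b := n - k%:Z.
pose Q := Qpoly R n m p k.
have dc := is_derive_exprz a c0 dcq.
have ds := is_derive_exprz b s0 dsq.
have dt := is_derive_tq sqx c0.
have dtp : is_derive x 1 (fun y => - tq p y ^+ p)
    (- (p%:R * tq p x ^+ p.-1 * cq p x ^- 2)).
  have -> : (fun y : R => - tq p y ^+ p) = - (tq p ^+ p).
    by apply/funext => y; rewrite !fctE.
  exact: is_derive_eq (is_deriveN (is_deriveX p dt)) _.
have dQ := @is_derive1_comp _ (horner Q) (fun y => - tq p y ^+ p) _ _ _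
  (is_derive_poly Q (- tq p x ^+ p)) dtp.
have -> : dpow k = (fun y : R => cq p y ^ a) * (fun y => sq p y ^ b) *
    (horner Q \o (fun y => - tq p y ^+ p)).
  by apply/funext => y; rewrite !fctE.
apply: is_derive_eq (is_deriveM (is_deriveM dc ds) dQ) _.
change (cq p x ^ a * sq p x ^ b *
    (Q^`()%R.[- tq p x ^+ p] * - (p%:R * tq p x ^+ p.-1 * cq p x ^- 2)) +
  Q.[- tq p x ^+ p] *
    (cq p x ^ a * (b%:~R * sq p x ^ (b - 1) * cq p x ^+ p.-1) +
     sq p x ^ b * (a%:~R * cq p x ^ (a - 1) * - sq p x ^+ p.-1)) =
  dpow k.+1 x).
(* Both sides have the factor [cq ^ (a - 1) * sq ^ (b - 1)]; with these two
   powers abstracted as [A] and [B], what remains has natural exponents. *)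
have aE : m - k.+1%:Z + (k.+1 * p)%:Z = a - 1 + p%:Z.
  by rewrite /a !PoszM -addn1 PoszD; ring.
have bE : n - k.+1%:Z = b - 1 by rewrite /b -addn1 PoszD; ring.
have -> : dpow k.+1 x = cq p x ^ (a - 1) * cq p x ^+ p * sq p x ^ (b - 1) *
    ((b%:~R - a%:~R * tq p x ^+ p) * Q.[- tq p x ^+ p] -
     p%:R * (tq p x ^+ p * (1 + tq p x ^+ p)) * Q^`()%R.[- tq p x ^+ p]).
  rewrite /dpow aE bE (expfzDr _ _ c0) -exprnP /= -/Q -/b.
  have -> : m + k%:Z * (p%:Z - 1) = a by rewrite /a PoszM; ring.
  by rewrite !hornerE/=; ring.
have -> : cq p x ^ a = cq p x ^ (a - 1) * cq p x.
  by rewrite -[X in _ * X]expr1z -expfzDr// subrK.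
have -> : sq p x ^ b = sq p x ^ (b - 1) * sq p x.
  by rewrite -[X in _ * X]expr1z -expfzDr// subrK.
move: (Q.[_]) (Q^`()%R.[_]) (cq p x ^ (a - 1)) (sq p x ^ (b - 1)) => q q' A B.
have expE (y : R) : y ^+ p = y * y ^+ p.-1 by rewrite -exprS prednK// ltnW.
rewrite /tq !expr_div_n !expE in sc1 *.
have c'0 : cq p x ^+ p.-1 != 0 by rewrite expf_neq0.
rewrite {dsq dcq dc ds dt dtp dQ sqx aE bE expE}.
move: (sq p x) (cq p x) s0 c0 c'0 sc1 => s c s0 c0.
move: (s ^+ p.-1) (c ^+ p.-1) => s' c' c'0 sc1.
have -> : 1 + s * s' / (c * c') = (c * c')^-1.
  by rewrite -[RHS]mul1r -[in RHS]sc1; field; rewrite c0 c'0.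
field.
by rewrite c0 c'0.
Qed.

Lemma dpow0 : dpow 0 = f.
Proof.
apply/funext => x; rewrite /dpow mul0n /= hornerC mulr1.
have -> : m - 0%:Z + 0%:Z = m by ring.
by have -> : n - 0%:Z = n by ring.
Qed.

(** A derivative at [t] depends on values near [t]; the induction on [k] thus
    needs the good points to form an open set. *)
Lemma derive1n_dpow (U : set R) : open U ->
  (forall t, U t -> [/\ squine_at p t, sq p t != 0 & cq p t != 0]) ->
  forall k t, U t -> derive1n k f t = dpow k t.
Proof.
move=> oU goodU; elim=> [|k IH] t Ut; first by rewrite dpow0.
have [sqt s0 c0] := goodU t Ut.
rewrite derive1nS derive1E.
have nearE : \near t, derive1n k f t = dpow k t.
  by near=> y; apply: IH; near: y; exact: open_nbhs_nbhs.
rewrite (near_eq_derive _ nearE).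
by have [_ ->] := is_derive_dpow k sqt s0 c0.
Unshelve. all: by end_near. Qed.

Lemma derivable_derive1n (U : set R) : open U ->
  (forall t, U t -> [/\ squine_at p t, sq p t != 0 & cq p t != 0]) ->
  forall k t, U t -> derivable (derive1n k f) t 1.
Proof.
move=> oU goodU k t Ut; have [sqt s0 c0] := goodU t Ut.
apply: (@near_eq_derivable _ _ _ (dpow k)).
  near=> y; apply/esym/(derive1n_dpow oU goodU); near: y.
  exact: open_nbhs_nbhs.
by case: (is_derive_dpow k sqt s0 c0).
Unshelve. all: by end_near. Qed.

End derivatives.

Theorem theorem2p1 (R : realType) (n m : int) (p : nat) (hp : (2 <= p)%N)
    (k : nat) (t : R)
    (ht : 0 < t < pip p / 2 \/ ~~ odd p /\ sq p t * cq p t <> 0) :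
  let f : R -> R := fun x => cq p x ^ m * sq p x ^ n in
  (forall j : nat, (j < k)%N -> derivable (derive1n j f) t 1) /\
  derive1n k f t =
    cq p t ^ (m - k%:Z) * sq p t ^ (n - k%:Z) *
    ((Qpoly R n m p k).[- tq p t ^+ p] / (1 + tq p t ^+ p) ^+ k).
Proof.
move=> f.
have [U [oU goodU Ut]] : exists U : set R, [/\ open U,
    forall x, U x -> [/\ squine_at p x, sq p x != 0 & cq p x != 0] & U t].
  case: ht => [t01|[p_even /eqP sct]].
    exists `]0, pip p / 2[%classic; split; first exact: interval_open.
      by move=> x /=; rewrite in_itv; exact: first_quadrant.
    by rewrite /= in_itv.
  exists [set x | sq p x * cq p x != 0]; split=> //.
    rewrite openE => x /= scx; have [dsq dcq _] := even_squine_at hp p_even scx.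
    have cs : {for x, continuous (sq p \* cq p : R -> R)}.
      apply: continuousM; apply/differentiable_continuous/derivable1_diffP.
        by case: dsq.
      by case: dcq.
    exact: cvgr_neq0 cs scx.
  move=> x /= scx; split; first exact: even_squine_at.
    by apply: contraNneq scx => ->; rewrite mul0r.
  by apply: contraNneq scx => ->; rewrite mulr0.
split; first by move=> j _; exact: (derivable_derive1n hp oU goodU Ut).
have [sqt s0 c0] := goodU t Ut.
by rewrite (derive1n_dpow n m hp oU goodU)// dpowE.
Qed.
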